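(* Let $d\ge1$, $k\ge0$ and $N\ge1$ be integers. The dimension of the sparse space $\hat{\mathbf{V}}_N^k$ is $$\dim(\hat{\mathbf{V}}_N^k)=(k+1)^d\left\{\sum_{m=0}^{d-1}\binom{d}{m}\left((-1)^{d-m}+2^{N+m-d+1}\sum_{n=0}^{d-m-1}\binom{N}{n}(-2)^{d-m-1-n}\right)+1\right\}.$$ Moreover, if there is an upper bound $d\le d_0$ on the dimension, then there exist positive constants $c_{d_0},C_{d_0}$ depending only on $d_0$ such that $$c_{d_0}(k+1)^d2^NN^{d-1}\le\dim(\hat{\mathbf{V}}_N^k)\le C_{d_0}(k+1)^d2^NN^{d-1}.$$
   Context: On $[0,1]$ let $I_n^j=(2^{-n}j,2^{-n}(j+1)]$, $j=0,\dots,2^n-1$, and let $V_n^k=\{v: v|_{I_n^j}\text{ is a polynomial of degree at most }k\ \forall j=0,\dots,2^n-1\}$, so $V_0^k\subset V_1^k\subset\cdots$. Let $W_0^k=V_0^k$ and, for $n\ge1$, let $W_n^k$ be the orthogonal complement of $V_{n-1}^k$ in $V_n^k$ with respect to the $L^2(0,1)$ inner product. For $\mathbf{l}=(l_1,\dots,l_d)\in\mathbb{N}_0^d$ put $|\mathbf{l}|_1=\sum_{m=1}^dl_m$ and let $\mathbf{W}_{\mathbf{l}}^k=W_{l_1,x_1}^k\times\cdots\times W_{l_d,x_d}^k$ denote the tensor product space on $[0,1]^d$, where $W_{l_m,x_m}^k$ is the space $W_{l_m}^k$ in the variable $x_m$. Define $\hat{\mathbf{V}}_N^k=\bigoplus_{|\mathbf{l}|_1\le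 N}\mathbf{W}_{\mathbf{l}}^k$. *)

(* Defs.v *)
From mathcomp Require Import all_boot all_order all_algebra.
From mathcomp Require Import all_classical all_reals all_analysis.

Set Implicit Arguments.
Unset Strict Implicit.
Unset Printing Implicit Defensive.

Import Order.TTheory GRing.Theory Num.Theory.
Import numFieldNormedType.Exports.

Local Open Scope classical_set_scope.
Local Open Scope ring_scope.

Section LinearAlgebra.
Context {K : fieldType} {E : lmodType K}.
Implicit Types (S : set E) (n : nat).

Definition lin_span S : set E :=
  [set v | exists n (a : 'I_n -> K) (b : 'I_n -> E),
     (forall i, S (b i)) /\ v = \sum_i a i *: b i].

Definition lin_indep n (b : 'I_n -> E) : Prop :=
  forall a : 'I_n -> K, \sum_i a i *: b i = 0 -> forall i, a i = 0.

Definition is_basis S n (b : 'I_n -> E) : Prop :=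
  lin_indep b /\ lin_span (range b) = S.

Definition fin_dim S : Prop := exists n (b : 'I_n -> E), is_basis S b.

(* Only meaningful when [fin_dim S] holds; then [lin_dimE] applies. *)
Definition lin_dim S : nat :=
  xget 0%N [set n | exists b : 'I_n -> E, is_basis S b].

Lemma lin_span_range n (b : 'I_n -> E) v :
  lin_span (range b) v -> exists a : 'I_n -> K, v = \sum_i a i *: b i.
Proof.
case=> m [a [c [cb ->]]].
have /choice [f fE] : forall i, exists j, b j = c i.
  by move=> i; have [j _ <-] := cb i; exists j.
exists (fun j => \sum_(i | f i == j) a i).
rewrite (partition_big f predT) //=; apply: eq_bigr => j _.
by rewrite scaler_suml; apply: eq_bigr => i /eqP <-; rewrite fE.
Qed.

Lemma is_basis_leq S m n (b : 'I_m -> E) (c : 'I_n -> E) :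
  is_basis S b -> is_basis S c -> (m <= n)%N.
Proof.
move=> [bfree bS] [_ cS]; rewrite leqNgt; apply/negP => ltnm.
have /choice [A AE] : forall i, exists a : 'I_n -> K, b i = \sum_j a j *: c j.
  move=> i; apply: lin_span_range; rewrite cS -bS.
  exists 1%N, (fun=> 1), (fun=> b i); split; first by move=> _; exists i.
  by rewrite big_ord1 scale1r.
pose M := \matrix_(i, j) A i j : 'M[K]_(m, n).
have /rowV0Pn [v vM vN0] : kermx M != 0.
  rewrite -mxrank_eq0 mxrank_ker -lt0n subn_gt0.
  exact: leq_ltn_trans (rank_leq_col _) ltnm.
case/eqP: vN0; apply/rowP => i; rewrite mxE; apply: (bfree (v 0)).
under eq_bigr do rewrite AE scaler_sumr.
rewrite exchange_big big1 //= => j _.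
under eq_bigr do rewrite scalerA.
rewrite -scaler_suml; have /sub_kermxP /rowP /(_ j) := vM.
by rewrite !mxE; under eq_bigr do rewrite mxE; move=> ->; rewrite scale0r.
Qed.

Lemma lin_dimE S n (b : 'I_n -> E) : is_basis S b -> lin_dim S = n.
Proof.
move=> bS; rewrite /lin_dim; case: xgetP => [m _ [c cS]|/(_ n)/=]; last first.
  by case; exists b.
by apply/eqP; rewrite eqn_leq !(@is_basis_leq S _ _ b c, @is_basis_leq S _ _ c b).
Qed.

End LinearAlgebra.

Section SparseSpace.
Context {R : realType}.

Definition dyadic_itv (n j : nat) : set R :=
  [set` `]2 ^- n * j%:R, 2 ^- n * j.+1%:R]].

(* The intervals [dyadic_itv n j], [j < 2 ^ n], partition ]0, 1], so two
   elements of V_n^k that agree almost everywhere agree on ]0, 1].  The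
   elements of V_n^k, which are only considered up to null sets, are therefore
   represented by functions on ]0, 1], extended by 0 to the real line; without
   this normalization the value at 0 would be a spurious degree of freedom. *)
Definition V_space (k n : nat) : set (R -> R^o) :=
  [set v | (forall x, x \notin `]0, 1] -> v x = 0) /\
     forall j, (j < 2 ^ n)%N -> exists p : {poly R},
       (size p <= k.+1)%N /\ forall x, dyadic_itv n j x -> v x = p.[x]].

Definition L2_inner (f g : R -> R^o) : R :=
  \int[lebesgue_measure]_(x in [set` `]0, 1[]) (f x * g x).

Definition W_space (k n : nat) : set (R -> R^o) :=
  if n is n'.+1 then
    [set w | V_space k n w /\ forall v, V_space k n' v -> L2_inner w v = 0]
  else V_space k 0.

Definition tensor_fun d (f : 'I_d -> R -> R^o) : 'rV[R]_d -> R^o :=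
  fun x => \prod_(m < d) f m (x 0 m).

Definition tensor_W k d (l : 'I_d -> nat) : set ('rV[R]_d -> R^o) :=
  lin_span [set tensor_fun f | f in [set f | forall m, W_space k (l m) (f m)]].

(* The sum of a family of subspaces is the span of their union. *)
Definition sparse_V k d N : set ('rV[R]_d -> R^o) :=
  lin_span (\bigcup_(l in [set l : 'I_d -> nat | (\sum_(m < d) l m <= N)%N])
              tensor_W k l).

End SparseSpace.

Arguments sparse_V R k d N : clear implicits.

(* Main.v *)
Require Import Defs.
From mathcomp Require Import all_boot all_order all_algebra.
From mathcomp Require Import all_classical all_reals all_analysis.
From mathcomp Require Import measurable_realfun finmap ring lra zify.

Import Order.TTheory GRing.Theory Num.Theory.
Import Defs.
Local Open Scope ring_scope.

Set Implicit Arguments.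
Unset Strict Implicit.
Unset Printing Implicit Defensive.

(** The sparse space is a sum of tensor products of the one-dimensional detail
    spaces W_l, so its dimension is a weighted count of the multi-levels l with
    |l| <= N.

    In one variable, V_n has the basis x^i * 1_I, with i <= k and I a dyadic
    interval of level n, hence dimension (k+1) 2^n.  The L^2 form is definite on
    V_n, because a polynomial that vanishes almost everywhere on an interval is
    zero; therefore the orthogonal complement W_(n+1) of V_n in V_(n+1) has
    dimension (k+1) 2^n ([W_space_basis]), and the spaces W_0, ..., W_N are
    pairwise orthogonal, hence independent ([W_family_free]).  In d variables,
    products of members of a free family of functions of one variable form a
    free family ([tensor_free]), so the products of basis elements of the W_l
    with total level at most N form a basis of the sparse space
    ([sparse_basis]).  With w_0 = 1 and w_(l+1) = 2^l, the dimension is thus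

      (k+1)^d * level_count d N,  level_count d N = sum_(|l| <= N) prod_m w_(l_m).

    For the closed form, splitting off one coordinate, whose level is either zero
    or positive, gives level_count (d+1) = level_count d + P (level_count d),
    where P ([pos_conv]) is the convolution with the weights of the positive
    levels.  Hence level_count d = sum_p 'C(d, p) P^p 1 by the binomial theorem,
    and P^p 1 is computed by checking that the stated expression
    ([pos_level_sum]) satisfies the recursion that defines P.

    For the growth, the same recursion and Pascal's rule yield
    2^N 'C(N+d, d) / 2^d <= level_count (d+1) N <= 2^N 'C(N+d, d), and
    N^d / d! <= 'C(N+d, d) <= (N+1)^d <= (2 N)^d. *)

(** * Spans and bases *)

Section Families.
Context {K : fieldType} {E : lmodType K}.

Lemma mem_lin_span (S : set E) v : S v -> lin_span S v.
Proof.
by exists 1%N, (fun=> 1), (fun=> v); split=> //; rewrite big_ord1 scale1r.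
Qed.

Lemma lin_span_sum (S : set E) (I : finType) (A : {set I}) (a : I -> K)
    (b : I -> E) :
  (forall i, i \in A -> S (b i)) -> lin_span S (\sum_(i in A) a i *: b i).
Proof.
move=> Sb; exists #|A|, (a \o enum_val), (b \o enum_val); split=> [i|].
  by apply: Sb; apply: enum_valP.
by rewrite big_enum_val.
Qed.

Lemma lin_span_sumT (S : set E) (I : finType) (a : I -> K) (b : I -> E) :
  (forall i, S (b i)) -> lin_span S (\sum_i a i *: b i).
Proof.
move=> Sb.
have -> : \sum_i a i *: b i = \sum_(i in [set: I]%SET) a i *: b i.
  by apply: eq_bigl => i; rewrite finset.in_setT.
by apply: lin_span_sum.
Qed.

Lemma lin_span_scaleD (S : set E) a u v :
  lin_span S u -> lin_span S v -> lin_span S (a *: u + v).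
Proof.
move=> [m [f [b [Sb ->]]]] [n [g [c [Sc ->]]]].
pose h (x : 'I_m + 'I_n) := match x with inl i => a * f i | inr i => g i end.
pose e (x : 'I_m + 'I_n) := match x with inl i => b i | inr i => c i end.
have := @lin_span_sumT S _ h e; rewrite big_sumType /= scaler_sumr.
under [X in _ -> lin_span S (X + _)]eq_bigr do rewrite scalerA.
by apply; case.
Qed.

Lemma lin_span_idem (S : set E) : lin_span (lin_span S) = lin_span S.
Proof.
apply/seteqP; split=> [v [n [a [b [Sb ->]]]]|v]; last exact: mem_lin_span.
elim/big_ind: _ => [|u w Su Sw|i _].
- by exists 0%N, (fun=> 0), (fun=> 0); split=> [[]|]; rewrite ?big_ord0.
- by rewrite -[u]scale1r; apply: lin_span_scaleD.
- rewrite -[X in lin_span _ X]addr0; apply: lin_span_scaleD => //.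
  by exists 0%N, (fun=> 0), (fun=> 0); split=> [[]|]; rewrite ?big_ord0.
Qed.

Lemma lin_span_mono (S T : set E) : (S `<=` T -> lin_span S `<=` lin_span T)%classic.
Proof. by move=> ST v [n [a [b [Sb ->]]]]; exists n, a, b; split=> // i; apply: ST. Qed.

Lemma is_basisP (S : set E) n (b : 'I_n -> E) : is_basis S b ->
  forall v, S v <-> exists a : 'I_n -> K, v = \sum_i a i *: b i.
Proof.
move=> [_ <-] v; split; first exact: lin_span_range.
by case=> a ->; apply: lin_span_sumT => i; exists i.
Qed.

(** Bases naturally indexed by a subset of a finite type, such as intervals times
    degrees or tuples of bounded total level, are renumbered by an ordinal. *)
Lemma is_basis_subfamily (S : set E) (I : finType) (A : {set I}) (b : I -> E) :
    (forall a : I -> K,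
      \sum_(i in A) a i *: b i = 0 -> forall i, i \in A -> a i = 0) ->
    (forall v, S v <-> exists a : I -> K, v = \sum_(i in A) a i *: b i) ->
  is_basis S (fun j : 'I_#|A| => b (enum_val j)).
Proof.
move=> bfree bS; split=> [a a0 i|].
  have Ai := enum_valP i.
  have := bfree (fun x => a (enum_rank_in Ai x)); rewrite big_enum_val /=.
  under eq_bigr do rewrite enum_valK_in.
  by move=> /(_ a0 _ Ai); rewrite enum_valK_in.
apply/seteqP; split=> [v /lin_span_range[a ->]|v /bS[a ->]]; last first.
  rewrite big_enum_val.
  by apply: (@lin_span_sumT _ _ (a \o enum_val)) => i; exists i.
apply/bS; exists (fun x => if [pick i | enum_val i == x] is Some i then a i else 0).
rewrite [RHS]big_enum_val; apply: eq_bigr => i _.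
by case: pickP => [j /eqP/enum_val_inj ->|/(_ i)/eqP].
Qed.

End Families.

(** * Orthogonal complements for a definite form *)

Section OrthogonalComplement.
Context {K : fieldType} {E : lmodType K} (B : E -> E -> K) (S : set E).
Context (S0 : S 0) (SD : forall a u v, S u -> S v -> S (a *: u + v)).
Context (BC : forall u v, B u v = B v u).
Context (BD : forall a u v w, S u -> S v -> S w ->
  B (a *: u + v) w = a * B u w + B v w).
Context (B_aniso : forall v, S v -> B v v = 0 -> v = 0).

Lemma form0 w : S w -> B 0 w = 0.
Proof.
move=> Sw; have := BD 1 S0 S0 Sw; rewrite scale1r addr0 mul1r.
by move/eqP; rewrite -subr_eq0 opprD addrA subrr sub0r oppr_eq0 => /eqP.
Qed.

Lemma form_sum (I : finType) (P : pred I) (a : I -> K) (b : I -> E) w :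
  (forall i, S (b i)) -> S w ->
  S (\sum_(i | P i) a i *: b i) /\
  B (\sum_(i | P i) a i *: b i) w = \sum_(i | P i) a i * B (b i) w.
Proof.
move=> Sb Sw; apply: (big_ind2 (fun x y => S x /\ B x w = y)).
- by split; rewrite ?form0.
- move=> u x v y [Su <-] [Sv <-].
  by rewrite -[u in u + v]scale1r BD // mul1r; split=> //; apply: SD.
- move=> i _; split; first by rewrite -[_ *: _]addr0; apply: SD.
  by rewrite -[_ *: _]addr0 BD // form0 // addr0.
Qed.

(** Pairing a vanishing sum of orthogonal vectors with one of its terms u i leaves
    B (u i) (u i) = 0. *)
Lemma orth_sum_eq0 (I : finType) (u : I -> E) :
    (forall i, S (u i)) -> (forall i j, i != j -> B (u i) (u j) = 0) ->
  \sum_i u i = 0 -> forall i, u i = 0.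
Proof.
move=> Su orth u0 i; apply: B_aniso => //.
have [_] := @form_sum _ predT (fun=> 1) u (u i) Su (Su i).
under eq_bigr do rewrite scale1r.
rewrite u0 form0 // (bigD1 i) //= mul1r big1 ?addr0 // => j ji.
by rewrite orth ?mulr0.
Qed.

(** The complement of T in S is the left kernel of the n x m matrix of the values
    of B on the two bases.  This matrix has full rank m, because a vector of T
    orthogonal to S is orthogonal to itself and thus zero. *)
Lemma orth_compl_basis n m (b : 'I_n -> E) (T : set E) (c : 'I_m -> E) :
    is_basis S b -> is_basis T c -> (T `<=` S)%classic ->
  exists e : 'I_(n - m) -> E,
    is_basis [set w | S w /\ forall v, T v -> B w v = 0]%classic e.
Proof.
move=> bS cT TS; have bSP := is_basisP bS; have cTP := is_basisP cT.
have Sb i : S (b i) by rewrite -bS.2; apply: mem_lin_span; exists i.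
have Tc i : T (c i) by rewrite -cT.2; apply: mem_lin_span; exists i.
have Sc i : S (c i) by apply: TS.
pose A := \matrix_(i, j) B (b i) (c j).
have BA (x : 'rV_n) : (forall j, B (\sum_i x 0 i *: b i) (c j) = (x *m A) 0 j).
  move=> j; rewrite (form_sum _ _ Sb (Sc j)).2 mxE.
  by apply: eq_bigr => i _; rewrite mxE.
have rA : \rank A = m.
  apply/eqP; rewrite -mxrank_tr -[_ == _]/(row_free _) -kermx_eq0.
  apply/negPn/negP => /rowV0Pn[x /sub_kermxP xA /negP[]].
  apply/eqP/rowP => j; rewrite mxE; apply: cT.1 => {j}.
  pose v := \sum_j x 0 j *: c j; rewrite -/v.
  have Tv : T v by apply/cTP; exists (x 0).
  apply: B_aniso; first exact: TS.
  have /bSP[a {1}->] := TS _ Tv.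
  have [_ ->] := form_sum predT a Sb (TS _ Tv).
  apply: big1 => i _; rewrite BC.
  have [_ ->] := form_sum predT (x 0) Sc (Sb i).
  have /rowP/(_ i) := xA; rewrite !mxE => xAi; rewrite -[RHS](mulr0 (a i)) -[in RHS]xAi.
  by congr (_ * _); apply: eq_bigr => j _; rewrite !mxE BC.
have rk : \rank (kermx A) = (n - m)%N by rewrite mxrank_ker rA.
rewrite -rk; have [M [Mfree MA]] : exists M : 'M[K]_(\rank (kermx A), n),
    row_free M /\ (M :=: kermx A)%MS.
  by exists (row_base (kermx A)); rewrite row_base_free; split=> //; apply: eq_row_base.
exists (fun i => \sum_j M i j *: b j).
have sumM (a : 'I_(\rank (kermx A)) -> K) :
    \sum_i a i *: (\sum_j M i j *: b j) =
    \sum_j (\row_i a i *m M) 0 j *: b j.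
  under eq_bigr do rewrite scaler_sumr.
  rewrite exchange_big; apply: eq_bigr => j _; rewrite mxE scaler_suml.
  by apply: eq_bigr => i _; rewrite scalerA mxE.
split=> [a|].
  rewrite sumM => /bS.1 aM0 i.
  have /eqP : \row_i a i *m M = 0 by apply/rowP => j; rewrite aM0 mxE.
  by rewrite mulmx_free_eq0 // => /eqP/rowP/(_ i); rewrite !mxE.
apply/seteqP; split=> [u /lin_span_range[a ->]|w [/bSP[a ->] aT]].
  rewrite sumM; set w := \sum_j _.
  have Sw : S w by apply/bSP; eexists.
  split=> // v /cTP[x ->]; rewrite BC.
  have [_ ->] := form_sum predT x Sc Sw; apply: big1 => j _.
  rewrite BC BA -mulmxA; have /eqP -> : M *m A == 0.
    by apply/eqP/sub_kermxP; rewrite MA.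
  by rewrite mulmx0 mxE mulr0.
have : (\row_i a i <= M)%MS.
  rewrite MA; apply/sub_kermxP/rowP => j; rewrite -BA [RHS]mxE.
  under eq_bigr do rewrite mxE.
  exact: aT.
case/submxP => D aD; exists _, (D 0), (fun i => \sum_j M i j *: b j).
split=> [i|]; first by exists i.
rewrite sumM; apply: eq_bigr => j _.
have -> : \row_i D 0 i = D by apply/rowP => i; rewrite mxE.
by rewrite -aD mxE.
Qed.

End OrthogonalComplement.

(** * Tensor products of free families *)

(** The function [untag 0 a] extends coefficients on one component of a disjoint
    union by zero, so combinations along different components can be written as
    sums over the same index type, as the expansion of a product requires. *)
Lemma sum_untag (K : pzRingType) (V : lmodType K) (I : finType) (J : I -> finType)
    i (a : J i -> K) (F : forall i, J i -> V) :
  \sum_(t : {i : I & J i}) untag 0 a t *: F _ (tagged t) = \sum_j a j *: F i j.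
Proof.
rewrite (bigID (fun t => tag t == i)) /= [X in _ + X]big1 ?addr0; last first.
  by move=> t ti; rewrite untag_dflt // scale0r.
have := @sig_big_dep _ 0 +%R I J (pred1 i) (fun _ => predT)
  (fun l j => untag 0 a (Tagged (fun l => J l) j) *: F l j).
rewrite big_pred1_eq => E.
transitivity (\sum_(j : J i) untag 0 a (Tagged (fun l => J l) j) *: F i j).
  rewrite E; apply: eq_big => [[l j]|[l j] _] //=; by rewrite andbT.
by apply: eq_bigr => j _; rewrite (@untagE _ _ _ _ _ _ (Tagged (fun l => J l : Type) j) (erefl i)).
Qed.

Section Tensor.
Context {R : realType}.

(** The coordinates are eliminated one at a time: with all other variables fixed,
    a vanishing combination is a combination of the e i in the variable x_j, whose
    coefficients must vanish by freeness.  Each step thus fixes one more index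
    of the surviving multi-indices, and after d steps a single one is left. *)
Lemma tensor_free d (I : finType) (e : I -> R -> R^o) :
    (forall a : I -> R, \sum_i a i *: e i = 0 -> forall i, a i = 0) ->
  forall a : {ffun 'I_d -> I} -> R,
    \sum_f a f *: tensor_fun (fun m => e (f m)) = 0 -> forall f, a f = 0.
Proof.
move=> efree a a0 g.
(* The multi-indices left after the first j coordinates have been eliminated. *)
pose agree j (f : {ffun 'I_d -> I}) := [forall m : 'I_d, (m < j)%N ==> (f m == g m)].
suff step j : (j <= d)%N -> forall x : 'rV[R]_d,
    \sum_(f | agree j f) a f * \prod_(m < d | (j <= m)%N) e (f m) (x 0 m) = 0.
  have := step d (leqnn d) 0; rewrite (big_pred1 g) => [|f].
    by rewrite big_pred0 ?mulr1 // => m; rewrite leqNgt ltn_ord.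
  apply/forallP/eqP => [fg|-> m]; last by rewrite eqxx implybT.
  by apply/ffunP => m; apply/eqP; have := fg m; rewrite ltn_ord.
elim: j => [_ x|j IH jd x].
  have /(congr1 (fun h => h x)) := a0; rewrite fct_sumE; apply: etrans.
  apply: eq_bigl => f; exact/forallP.
pose jo := Ordinal jd.
pose c i := \sum_(f | agree j f && (f jo == i))
  a f * \prod_(m < d | (j < m)%N) e (f m) (x 0 m).
have agreeS f : agree j f && (f jo == g jo) = agree j.+1 f.
  apply/andP/forallP => [[/forallP fg fj] m|fg]; last first.
    split; last by have := fg jo; rewrite ltnS leqnn.
    by apply/forallP => m; apply/implyP => mj; have := fg m; rewrite ltnS ltnW.
  apply/implyP; rewrite ltnS leq_eqVlt => /orP[/eqP mj|mj].
    by rewrite (_ : m = jo) ?fj //; apply: val_inj.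
  by have := fg m; rewrite mj.
rewrite -(eq_bigl _ _ agreeS); apply: (efree c _ (g jo)); apply/funext => y.
rewrite fct_sumE.
(* Only the j-th variable varies; it plays the role of y. *)
have := IH (ltnW jd) (\row_m if m == jo then y else x 0 m).
rewrite (partition_big (fun f : {ffun 'I_d -> I} => f jo) predT) //=; apply: etrans.
apply: eq_bigr => i _; rewrite [LHS]mulr_suml; apply: eq_bigr => f /andP[_ /eqP fi].
rewrite [in RHS](bigD1 jo) //= mxE eqxx fi mulrAC -mulrA; congr (_ * (_ * _)).
apply: eq_big => [m|m]; first by rewrite andbC ltn_neqAle eq_sym.
by move=> jm; rewrite mxE ifN // -val_eqE /= gtn_eqF.
Qed.

(** Spanning follows by expanding a product of elements of the W_(l_m) in the bases
    e; only multi-indices of levels l survive, and each l_m is at most N since the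
    total is. *)
Lemma sparse_basis k d N (n : nat -> nat) (e : forall l, 'I_(n l) -> R -> R^o) :
    (forall l, is_basis (W_space k l) (@e l)) ->
    let I := {l : 'I_N.+1 & 'I_(n l)} in
    (forall a : I -> R, \sum_t a t *: e _ (tagged t) = 0 -> forall t, a t = 0) ->
  exists b, is_basis (sparse_V R k d N)
    (b : 'I_#|[set f : {ffun 'I_d -> I} | (\sum_m tag (f m) <= N)%N]| -> _).
Proof.
move=> eW I efree; set A := finset _.
pose b (f : {ffun 'I_d -> I}) := tensor_fun (fun m => e _ (tagged (f m))).
exists (fun j => b (enum_val j)); apply: is_basis_subfamily => [a a0 f fA|].
  have := tensor_free efree (a := fun f => if f \in A then a f else 0).
  move=> /(_ _ f); rewrite fA; apply; rewrite -[RHS]a0 [RHS]big_mkcond /=.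
  by apply: eq_bigr => h _; case: ifP => // _; rewrite scale0r.
move=> v; split=> [|[a ->]]; last first.
  apply: lin_span_sum => f; rewrite inE => fN.
  exists (fun m => tag (f m) : nat) => //; apply: mem_lin_span.
  exists (fun m => e _ (tagged (f m))) => // m /=.
  by apply/(is_basisP (eW _)); exists (fun i => (i == tagged (f m))%:R);
    rewrite (bigD1 (tagged (f m))) //= eqxx scale1r big1 ?addr0 // => i /negPf ->;
    rewrite scale0r.
have spanA w : lin_span [set b f | f in [set f | f \in A]]%classic w ->
    exists a, w = \sum_(f in A) a f *: b f.
  move=> [p [a [c [cA ->]]]].
  have /choice[h hP] : forall i, exists f, f \in A /\ b f = c i.
    by move=> i; have [f fA <-] := cA i; exists f.
  exists (fun f => \sum_(i | h i == f) a i).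
  rewrite (partition_big h (mem A)) /= => [|i _]; last exact: (hP i).1.
  apply: eq_bigr => f _; rewrite scaler_suml; apply: eq_bigr => i /eqP <-.
  by rewrite (hP i).2.
move=> vsp; apply: spanA; rewrite -lin_span_idem.
move: v vsp; apply: lin_span_mono => v [l /= lN].
rewrite -lin_span_idem; apply: lin_span_mono => {}v [f fW <-].
have lN1 m : (l m < N.+1)%N.
  by rewrite ltnS (leq_trans _ lN) // (bigD1 m) //= leq_addr.
pose lo m := Ordinal (lN1 m).
have /choice[c cP] m : exists c : I -> R,
    (forall t, tag t != lo m -> c t = 0) /\ f m = \sum_t c t *: e _ (tagged t).
  have /(is_basisP (eW _))[a aE] := fW m.
  pose a' : {l : 'I_N.+1 & 'I_(n l)} -> R :=
    @untag _ (fun l : 'I_N.+1 => 'I_(n l)) _ 0 (lo m) a.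
  exists a'; split=> [t|]; first exact: untag_dflt.
  by rewrite (sum_untag _ (fun l : 'I_N.+1 => @e l)).
have -> : tensor_fun f =
    \sum_(h : {ffun 'I_d -> I}) (\prod_m c m (h m)) *: b h.
  apply/funext => x; rewrite fct_sumE /tensor_fun.
  under eq_bigr do rewrite (cP _).2 fct_sumE.
  rewrite bigA_distr_bigA; apply: eq_bigr => h _.
  by rewrite [LHS]big_split.
rewrite (bigID (mem A)) /= [X in _ + X]big1 ?addr0 => [|h hA].
  by apply: lin_span_sum => h hA; exists h.
(* Outside A some level differs from l_m, so the coefficient is zero. *)
have [m hm] : exists m, tag (h m) != lo m.
  apply/existsP; apply: contraNT hA => /existsPn hlo.
  rewrite inE (leq_trans _ lN) //; apply: leq_sum => m _.
  by have := hlo m; rewrite negbK => /eqP ->.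
by rewrite (bigD1 m) //= (cP m).1 // mul0r scale0r.
Qed.

End Tensor.

(** * Counting multi-levels *)

(** Unfolding the recursion gives pos_conv f n = sum_(i < n) 2^i f (n - 1 - i): the
    convolution of f with the weights 2^(l-1) of the levels l >= 1. *)
Fixpoint pos_conv (R : pzSemiRingType) (f : nat -> R) (n : nat) : R :=
  if n is n'.+1 then f n' + 2 * pos_conv f n' else 0.

(** The sum of prod_m w_(l_m) over the l in N^d with |l| <= N, computed by
    splitting off one coordinate; that it is this sum is [card_level_sum]. *)
Fixpoint level_count (d : nat) : nat -> nat :=
  if d is d'.+1 then fun N => (level_count d' N + pos_conv (level_count d') N)%N
  else fun=> 1%N.

Arguments level_count : simpl never.

Definition level_weight (l : nat) : nat := if l is l'.+1 then (2 ^ l')%N else 1%N.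

Lemma pos_convSn (f : nat -> nat) n :
  pos_conv f n.+1 = (f n + 2 * pos_conv f n)%N.
Proof. by []. Qed.

Lemma level_countE d n :
  level_count d.+1 n = (level_count d n + pos_conv (level_count d) n)%N.
Proof. by []. Qed.

Lemma level_countS d n :
  (level_count d.+1 n.+1 + level_count d n =
   2 * level_count d.+1 n + level_count d n.+1)%N.
Proof. by rewrite !level_countE pos_convSn; lia. Qed.

(** The generating polynomial of the weights.  Truncation at N does not affect the
    coefficients up to N of its powers. *)
Definition level_poly N : {poly int} := \poly_(l < N.+1) (level_weight l)%:R.

(** This is the identity sum_l w_l X^l = (1 - X) / (1 - 2 X), up to X^N, with the
    denominator cleared. *)
Lemma level_poly_rec N s : (s < N)%N ->
  forall q : {poly int},
  (q * level_poly N)`_s.+1 = 2 * (q * level_poly N)`_s + q`_s.+1 - q`_s.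
Proof.
move=> sN q; have : level_poly N * (1 - 2%:P * 'X) =
    1 - 'X - (2 ^+ N)%:P * 'X^(N.+1).
  apply/polyP => i; rewrite mulrBr mulr1 mulrA !coefB !coefCM
    coefXn coefMX coefMC coef1 coefX !coef_poly.
  case: i => [|[|i]] /=; first by rewrite !subr0 mulr0.
    by case: N sN => // N _; rewrite mulr0 subr0.
  rewrite !ltnS !eqSS natrX exprSr.
  case: (ltnP i.+1 N) => h1; case: (ltnP i N) => h2; case: (eqVneq i.+1 N) => h3;
    try (exfalso; lia); rewrite ?mulr0n ?mulr1n.
  - by rewrite natrX; ring.
  - by rewrite natrX -h3 exprSr; ring.
  - by ring.
move=> E; have : q * level_poly N - 2%:P * (q * level_poly N * 'X) =
    q - q * 'X - (2 ^+ N)%:P * (q * 'X^(N.+1)).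
  transitivity (q * (level_poly N * (1 - 2%:P * 'X))); first by ring.
  by rewrite E; ring.
move=> /(congr1 (fun p : {poly int} => p`_s.+1)).
rewrite !coefB !coefCM !coefMX coefMXn ltnS sN /=.
rewrite mulr0 subr0 => /eqP; rewrite subr_eq => /eqP ->; ring.
Qed.

Lemma partial_sum_rec (c c' : nat -> int) N :
    c' 0%N = c 0%N ->
    (forall s, (s < N)%N -> c' s.+1 = 2 * c' s + c s.+1 - c s) ->
  forall m, (m < N)%N ->
    \sum_(s < m.+2) c' s = 2 * (\sum_(s < m.+1) c' s) +
      \sum_(s < m.+2) c s - \sum_(s < m.+1) c s.
Proof.
move=> cc0 rec; elim=> [|m IHm] mN.
  by rewrite !big_ord_recr !big_ord0 /= rec // cc0; ring.
have sumS (f : nat -> int) n : \sum_(s < n.+1) f s = \sum_(s < n) f s + f n.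
  by rewrite big_ord_recr.
by have := IHm (ltnW mN); have := rec _ mN; rewrite !sumS; lia.
Qed.

Lemma level_poly_count d N n : (n <= N)%N ->
  \sum_(s < n.+1) (level_poly N ^+ d)`_s = (level_count d n)%:R.
Proof.
elim: d n => [|d IHd] n nN.
  rewrite expr0 big_ord_recl coef1 big1 ?addr0 //= => i _.
  by rewrite coef1.
elim: n nN => [|n IHn] nN.
  rewrite big_ord1 exprSr coef0M level_countE /= addn0 -IHd // big_ord1.
  by rewrite coef_poly mulr1.
have coef0 m : (level_poly N ^+ m)`_0 = 1.
  elim: m => [|m IHm]; first by rewrite expr0 coef1.
  by rewrite exprS coef0M IHm coef_poly.
have step := @partial_sum_rec (fun s => (level_poly N ^+ d)`_s)
  (fun s => (level_poly N ^+ d.+1)`_s) N.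
rewrite step // ?coef0 // => [|s sN]; last by rewrite exprSr level_poly_rec.
rewrite IHn ?IHd ?(ltnW nN) //.
have := level_countS d n; lia.
Qed.

(** The number of admissible multi-indices is the sum of the coefficients up to N
    of (sum_t 'X^(level of t)) ^ d, and the sum over t is k + 1 times the
    generating polynomial of the weights. *)
Lemma card_level_sum (d k N : nat) :
  #|[set f : {ffun 'I_d -> {l : 'I_N.+1 & 'I_(level_weight l * k.+1)}} |
      (\sum_m tag (f m) <= N)%N]| = (k.+1 ^ d * level_count d N)%N.
Proof.
apply/eqP; rewrite -(eqr_nat int) natrM -(level_poly_count d (leqnn N)).
pose I : finType := ({l : 'I_N.+1 & 'I_(level_weight l * k.+1)} : finType).
have polyE : \sum_(t : I) 'X^(tag t) = (k.+1)%:R *: level_poly N.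
  rewrite /level_poly poly_def scaler_sumr.
  have := @sig_big_dep _ 0 +%R 'I_N.+1 (fun l => 'I_(level_weight l * k.+1)) predT
    (fun _ => predT) (fun l _ => 'X^l : {poly int}).
  move=> /= <-; apply: eq_bigr => l _.
  by rewrite sumr_const card_ord scalerA -natrM mulnC scaler_nat.
rewrite natrX mulr_sumr -sum1_card natr_sum; apply/eqP.
have powE : (k.+1)%:R ^+ d *: level_poly N ^+ d =
    \sum_(f : {ffun 'I_d -> I}) 'X^(\sum_m tag (f m)).
  rewrite -exprZn -polyE -[d in LHS]card_ord -prodr_const bigA_distr_bigA.
  by apply: eq_bigr => f _; rewrite -(big_morph _ (exprD _) (expr0 _)).
under [RHS]eq_bigr do rewrite -coefZ powE coef_sum.
rewrite exchange_big /= big_mkcond; apply: eq_bigr => f _.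
under [RHS]eq_bigr do rewrite coefXn.
rewrite inE; case: ifPn => [fN|]; last first.
  rewrite -ltnNge => fN; rewrite big1 // => s _.
  by rewrite ltn_eqF // (leq_trans (ltn_ord s)).
rewrite -ltnS in fN; rewrite (bigD1 (Ordinal fN)) //= eqxx big1 ?addr0 // => s sf.
by rewrite (negPf (_ : s != \sum_m tag (f m) :> nat)%N).
Qed.

(** * The closed form of the count *)

Section ClosedForm.
Context {R : numFieldType}.

Definition alt_binomial_sum p N : R := \sum_(0 <= n < p) 'C(N, n)%:R * (-2%:R) ^+ (p - 1 - n).

(** The value of the p-fold convolution P^p 1 at N, that is, the sum of
    2^(|l| - p) over the l in N^p with all entries positive and |l| <= N; see
    [pos_level_sumS]. *)
Definition pos_level_sum p N : R :=
  (-1) ^+ p + 2%:R ^ (N%:Z - p%:Z + 1) * alt_binomial_sum p N.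

Lemma alt_binomial_sumS p N :
  alt_binomial_sum p.+1 N.+1 = alt_binomial_sum p.+1 N + alt_binomial_sum p N.
Proof.
rewrite /alt_binomial_sum big_nat_recl // [in RHS]big_nat_recl // !bin0 -addrA; congr (_ + _).
rewrite -big_split /=; apply: eq_bigr => i _; rewrite binS natrD mulrDl.
by congr (_ + _ * _ ^+ _); lia.
Qed.

Lemma pos_level_sum0 N : pos_level_sum 0 N = 1.
Proof. by rewrite /pos_level_sum /alt_binomial_sum big_geq // mulr0 addr0. Qed.

(** Both sides satisfy the recursion of [pos_conv].  At N = 0 the two terms of the
    closed form cancel; the step is Pascal's rule, the power of 2 absorbing the
    shift of N - p. *)
Lemma pos_level_sumS p N : pos_level_sum p.+1 N = pos_conv (pos_level_sum p) N.
Proof.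
have n2 : 2%:R != 0 :> R by rewrite pnatr_eq0.
elim: N => [|N IH] /=.
  rewrite /pos_level_sum /alt_binomial_sum big_nat_recl // bin0 mul1r big1 => [|i _]; last first.
    by rewrite bin0n mul0r.
  rewrite !subn0 subn1 /= addr0.
  have -> : 0%:Z - p.+1%:Z + 1 = - p%:Z by lia.
  by rewrite -exprnN -exprVn -exprMn mulrN mulVf // exprS mulN1r addNr.
rewrite -IH /pos_level_sum alt_binomial_sumS.
have -> : N.+1%:Z - p.+1%:Z + 1 = (N%:Z - p.+1%:Z + 1) + 1 by lia.
have -> : N%:Z - p%:Z + 1 = (N%:Z - p.+1%:Z + 1) + 1 by lia.
rewrite expfzDr // expr1z exprS; ring.
Qed.

Lemma pos_conv_sum (I : Type) (r : seq I) (c : I -> R) (f : I -> nat -> R) N :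
  pos_conv (fun n => \sum_(i <- r) c i * f i n) N =
  \sum_(i <- r) c i * pos_conv (f i) N.
Proof.
elim: N => [|N IH] /=; first by rewrite big1 // => i _; rewrite mulr0.
rewrite IH mulr_sumr -big_split /=; apply: eq_bigr => i _; ring.
Qed.

Lemma natr_pos_conv (f : nat -> nat) N :
  (pos_conv f N)%:R = pos_conv (fun n => (f n)%:R) N :> R.
Proof. by elim: N => //= N <-; rewrite natrD natrM. Qed.

Lemma eq_pos_conv (f g : nat -> R) : f =1 g -> pos_conv f =1 pos_conv g.
Proof. by move=> fg; elim=> //= n ->; rewrite fg. Qed.

(** The binomial expansion of (1 + P)^d applied to the constant 1, where m counts
    the coordinates of level zero. *)
Lemma level_count_closed d N : (level_count d N)%:R =
  \sum_(0 <= m < d.+1) 'C(d, m)%:R * pos_level_sum (d - m) N.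
Proof.
elim: d N => [|d IH] N; first by rewrite big_nat1 pos_level_sum0 mulr1.
rewrite [LHS]natrD IH natr_pos_conv (eq_pos_conv IH) pos_conv_sum.
under [X in _ + X]eq_bigr do rewrite -pos_level_sumS.
rewrite [RHS]big_nat_recl // [X in _ + X]big_nat_recl //= !bin0 !subn0.
rewrite addrCA; congr (_ + _).
have -> : \sum_(0 <= i < d) 'C(d, i.+1)%:R * pos_level_sum (d - i.+1).+1 N =
  \sum_(0 <= i < d.+1) 'C(d, i.+1)%:R * pos_level_sum (d - i) N.
  rewrite [RHS]big_nat_recr //= bin_small // mul0r addr0.
  by apply: eq_big_nat => i id; rewrite subnSK.
rewrite -big_split /=; apply: eq_bigr => i _.
by rewrite subSS binS natrD mulrDl addrC.
Qed.

End ClosedForm.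

(** * The growth of the count *)

Lemma level_count1 N : level_count 1 N = (2 ^ N)%N.
Proof.
elim: N => // N IH; have := level_countS 0 N.
by rewrite IH expnS /level_count; lia.
Qed.

(** Pascal's rule for 2^N 'C(N+d, d+1) dominates the recursion that computes
    pos_conv (level_count (d+1)) N, so this term is at most 2^N 'C(N+d, d+1), and
    one more use of Pascal's rule adds the bound for level_count (d+1). *)
Lemma level_count_le d N : (level_count d.+1 N <= 2 ^ N * 'C(N + d, d))%N.
Proof.
elim: d N => [|d IH] N; first by rewrite bin0 muln1 level_count1.
have posle : (pos_conv (level_count d.+1) N <= 2 ^ N * 'C(N + d, d.+1))%N.
  elim: N => // N IHN.
  rewrite pos_convSn addSn binS expnS.
  have := IH N; move: IHN; lia.
rewrite level_countE addnS binS mulnDr addnC.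
exact: leq_add posle (IH N).
Qed.

(** The recursion of [pos_conv] involves 2^N where Pascal's rule for
    2^(N+1) 'C(N+1+d, d+1) requires 2^(N+1); each dimension therefore costs a
    factor 2. *)
Lemma level_count_ge d N : (2 ^ N * 'C(N + d, d) <= 2 ^ d * level_count d.+1 N)%N.
Proof.
elim: d N => [|d IH] N; first by rewrite bin0 muln1 level_count1 mul1n.
have posge : (2 ^ N * 'C(N + d, d.+1) <= 2 ^ d.+1 * pos_conv (level_count d.+1) N)%N.
  elim: N => [|N IHN]; first by rewrite add0n bin_small // muln0.
  rewrite pos_convSn addSn binS expnS.
  have := IH N; move: IHN; rewrite !expnS; lia.
rewrite level_countE addnS binS.
by have := IH N; move: posge; rewrite expnS; lia.
Qed.

Lemma bin_le_expn N d : ('C(N + d, d) <= N.+1 ^ d)%N.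
Proof.
elim: d => [|d IH]; first by rewrite bin0.
rewrite -(leq_pmul2l (ltn0Sn d)) -mul_bin_diag addnS /= expnS mulnA.
by apply: leq_mul => //; nia.
Qed.

Lemma expn_le_bin N d : (N ^ d <= d`! * 'C(N + d, d))%N.
Proof.
elim: d => [|d IH]; first by rewrite bin0.
rewrite factS mulnAC -mul_bin_diag addnS /= expnS -mulnA [('C(_, _) * _)%N]mulnC.
by apply: leq_mul => //; lia.
Qed.

Lemma level_count_lower d N :
  (2 ^ N * N ^ d <= 2 ^ d * d`! * level_count d.+1 N)%N.
Proof.
have := expn_le_bin N d; have := level_count_ge d N.
rewrite -(leq_pmul2l (fact_gt0 d)) => h1.
rewrite -(leq_pmul2l (expn_gt0 2 N : 0 < 2 ^ N)%N) => h2.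
apply: leq_trans h2 _; rewrite mulnCA (leq_trans h1) //.
by rewrite mulnA [(d`! * _)%N]mulnC.
Qed.

Lemma level_count_upper d N : (0 < N)%N ->
  (level_count d.+1 N <= 2 ^ d * 2 ^ N * N ^ d)%N.
Proof.
move=> N0; rewrite (leq_trans (level_count_le d N)) //.
rewrite [(2 ^ d * _)%N]mulnC -mulnA leq_mul2l -expnMn.
rewrite (leq_trans (bin_le_expn N d)) ?orbT //.
by case: d => // d; rewrite leq_exp2r //; lia.
Qed.

(** * Piecewise polynomials on dyadic intervals *)

Section PiecewisePolynomials.
Context {R : realType}.
Local Open Scope classical_set_scope.
Local Open Scope ring_scope.

Lemma finite_roots (p : {poly R}) : p != 0 -> finite_set [set x | root p x].
Proof.
move=> p0; apply: contrapT => /(@infinite_set_fset _ _ (size p))[B Broot].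
apply/negP; rewrite -ltnNge; apply: max_poly_roots => //.
  by apply/allP => x /Broot.
exact: fset_uniq.
Qed.

(** A nonzero polynomial has finitely many roots, which form a null set, whereas
    the interval has positive measure. *)
Lemma poly_ae0 (p : {poly R}) (a b : R) (N : set R) : a < b ->
    lebesgue_measure.-negligible N ->
    (forall x, a < x < b -> ~ N x -> p.[x] = 0) -> p = 0.
Proof.
move=> ab Nnull pN; apply/eqP/negPn/negP => p0.
have : lebesgue_measure.-negligible [set` `]a, b[].
  apply: (@negligibleS _ _ _ (@lebesgue_measure R) ([set x | root p x] `|` N)).
    move=> x /=; rewrite in_itv /= => xab.
    by have [Nx|Nx] := pselect (N x); [right|left; apply/rootP/pN].
  apply: negligibleU => //.
  have cr : countable [set x | root p x] by apply/finite_set_countable/finite_roots.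
  by exists [set x | root p x]; split=> //;
    [exact: countable_measurable|exact: countable_lebesgue_measure0].
move=> abnull; have := (negligibleP lebesgue_measure (measurable_itv _)).1 abnull.
rewrite /= lebesgue_measure_itv /= lte_fin ab => /eqP.
by rewrite -EFinD eqe subr_eq0 gt_eqF.
Qed.

Lemma dyadic_itvE n j (x : R) :
  dyadic_itv n j x <-> j%:R < 2 ^+ n * x <= j.+1%:R.
Proof.
rewrite /dyadic_itv /= in_itv /=.
by rewrite -ltr_pdivrMl ?exprn_gt0// -ler_pdivlMl ?exprn_gt0.
Qed.

Lemma dyadic_itv_uniq n i j (x : R) : dyadic_itv n i x -> dyadic_itv n j x -> i = j.
Proof.
move=> /dyadic_itvE/andP[ix xi] /dyadic_itvE/andP[jx xj].
have := lt_le_trans ix xj; have := lt_le_trans jx xi.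
by rewrite !ltr_nat !ltnS => ij ji; apply/eqP; rewrite eqn_leq ij ji.
Qed.

Lemma dyadic_itv_cover n (x : R) : x \in `]0, 1] ->
  exists2 j, (j < 2 ^ n)%N & dyadic_itv n j x.
Proof.
rewrite in_itv /= => /andP[x0 x1].
have yn : 2 ^+ n * x <= (2 ^ n)%:R.
  by rewrite natrX ger_pMr ?exprn_gt0.
have exm : exists m, 2 ^+ n * x <= m%:R by exists (2 ^ n)%N.
(* With m the ceiling of 2^n x, the interval has index m - 1, by half-openness. *)
case: (ex_minnP exm) => -[|m] ym mmin.
  by move: ym; rewrite leNgt mulr_gt0 ?exprn_gt0.
exists m; first exact: mmin yn.
apply/dyadic_itvE; rewrite ym andbT ltNge; apply/negP => /mmin.
by rewrite ltnn.
Qed.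

Lemma dyadic_itv_sub n j (x : R) : (j < 2 ^ n)%N -> dyadic_itv n j x -> x \in `]0, 1].
Proof.
move=> jn /dyadic_itvE/andP[jx xj]; rewrite in_itv /=.
have n0 : 0 < 2 ^+ n :> R by rewrite exprn_gt0.
have := le_lt_trans (ler0n R j) jx; rewrite pmulr_rgt0 // => -> /=.
by rewrite -(ler_pM2l n0) mulr1 (le_trans xj) // -natrX ler_nat.
Qed.

Definition dyadic_monomial k n (t : 'I_(2 ^ n) * 'I_k.+1) : R -> R^o :=
  fun x => \1_(dyadic_itv n t.1) x * x ^+ t.2.

(** Exactly one dyadic interval of level n contains x, so a combination of the
    basis functions evaluates to a single polynomial there. *)
Lemma sum_dyadic_monomial k n (c : 'I_(2 ^ n) * 'I_k.+1 -> R) (j : 'I_(2 ^ n)) x :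
  dyadic_itv n j x ->
  (\sum_t c t *: dyadic_monomial t) x = (\poly_(i < k.+1) c (j, inord i)).[x].
Proof.
move=> jx; rewrite fct_sumE.
transitivity (\sum_a \sum_b c (a, b) *: dyadic_monomial (a, b) x).
  by rewrite pair_bigA; apply: eq_bigr => -[].
rewrite (bigD1 j) //= [X in _ + X]big1 ?addr0 => [|a aj].
  rewrite horner_poly; apply: eq_bigr => i _.
  by rewrite inord_val /dyadic_monomial /= indicE mem_set // mul1r.
apply: big1 => i _; rewrite /dyadic_monomial /= indicE memNset ?mul0r ?scaler0 // => ax.
by case/eqP: aj; apply: val_inj; apply: dyadic_itv_uniq ax jx.
Qed.

Lemma sum_dyadic_monomial0 k n (c : 'I_(2 ^ n) * 'I_k.+1 -> R) x :
  x \notin `]0, 1] -> (\sum_t c t *: dyadic_monomial t) x = 0.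
Proof.
move=> x01; rewrite fct_sumE big1 // => t _.
rewrite -[LHS]/(c t *: dyadic_monomial t x) /dyadic_monomial indicE memNset ?mul0r ?scaler0 //.
by move=> /(dyadic_itv_sub (ltn_ord _)); apply/negP.
Qed.

Lemma V_spaceP k n v : V_space k n v <->
  exists c : 'I_(2 ^ n) * 'I_k.+1 -> R, v = \sum_t c t *: dyadic_monomial t.
Proof.
split=> [[v0 vp]|[c ->]]; last first.
  split=> [x|j jn]; first exact: sum_dyadic_monomial0.
  exists (\poly_(i < k.+1) c (Ordinal jn, inord i)); split; first exact: size_poly.
  by move=> x jx; apply: sum_dyadic_monomial.
have /choice[p pP] (j : 'I_(2 ^ n)) := vp _ (ltn_ord j).
exists (fun t : 'I_(2 ^ n) * 'I_k.+1 => (p t.1)`_t.2); apply/funext => x.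
have [x01|x01] := boolP (x \in `]0, 1]); last by rewrite v0 // sum_dyadic_monomial0.
have [j jn jx] := dyadic_itv_cover n x01.
rewrite (sum_dyadic_monomial _ (jx : dyadic_itv n (Ordinal jn) x)) ((pP (Ordinal jn)).2 _ jx) /=.
congr _.[x]; apply/polyP => i; rewrite coef_poly.
case: ltnP => ik; first by rewrite inordK.
by rewrite nth_default // (leq_trans (pP (Ordinal jn)).1).
Qed.

Lemma V_space_basis k n : exists b : 'I_(2 ^ n * k.+1) -> R -> R^o,
  is_basis (V_space k n) b.
Proof.
suff [b bV] : exists b : 'I_#|[set: 'I_(2 ^ n) * 'I_k.+1]%SET| -> R -> R^o,
    is_basis (V_space k n) b.
  by move: b bV; rewrite cardsT card_prod !card_ord => b bV; exists b.
exists (fun j => dyadic_monomial (enum_val j)); apply: is_basis_subfamily => [c|v].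
  rewrite (eq_bigl predT) => [c0 [j i] _|t]; last by rewrite inE.
  have : \poly_(i < k.+1) c (j, inord i) = 0.
    apply: (@poly_ae0 _ (2 ^- n * j%:R) (2 ^- n * j.+1%:R) set0) => [||x jx _].
    - by rewrite ltr_pM2l ?invr_gt0 ?exprn_gt0 // ltr_nat.
    - exact: negligible_set0.
    rewrite -sum_dyadic_monomial ?c0 // /dyadic_itv /= in_itv /=.
    by case/andP: jx => -> /ltW ->.
  by move=> /polyP/(_ i); rewrite coef_poly ltn_ord inord_val coef0.
rewrite V_spaceP; split=> -[c ->]; exists c.
  by apply: eq_bigl => t; rewrite inE.
by apply: eq_bigl => t; rewrite inE.
Qed.

Lemma V_spaceS k n : V_space k n `<=` @V_space R k n.+1.
Proof.
move=> v [v0 vp]; split=> // j jn.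
have jn2 : (j %/ 2 < 2 ^ n)%N by rewrite ltn_divLR // -expnSr.
have [p [sp pP]] := vp _ jn2; exists p; split=> // x jx; apply: pP.
move: jx => /dyadic_itvE; rewrite exprS -mulrA => /andP[jx xj].
have j1 : ((j %/ 2) * 2)%:R <= j%:R :> R by rewrite ler_nat leq_divM.
have j2 : j.+1%:R <= ((j %/ 2).+1 * 2)%:R :> R by rewrite ler_nat ltn_ceil.
by apply/dyadic_itvE; move: j1 j2; rewrite !natrM; lra.
Qed.

Lemma V_space_le k m n : (m <= n)%N -> V_space k m `<=` @V_space R k n.
Proof.
move=> /subnKC <-; elim: (n - m)%N => [|i IH]; first by rewrite addn0.
by rewrite addnS; apply: subset_trans IH (@V_spaceS _ _).
Qed.

Lemma V_space0 k n : @V_space R k n 0.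
Proof. by apply/V_spaceP; exists (fun=> 0); rewrite big1 // => t _; rewrite scale0r. Qed.

Lemma V_space_scaleD k n a (u v : R -> R^o) :
  V_space k n u -> V_space k n v -> V_space k n (a *: u + v).
Proof.
move=> /V_spaceP[c ->] /V_spaceP[e ->]; apply/V_spaceP.
exists (fun t => a * c t + e t); rewrite scaler_sumr -big_split /=.
by apply: eq_bigr => t _; rewrite scalerDl scalerA.
Qed.

Lemma V_spaceM k n (u v : R -> R^o) :
  V_space k n u -> V_space k n v -> V_space (k + k) n (fun x => u x * v x).
Proof.
move=> [u0 up] [v0 vp]; split=> [x x01|j jn]; first by rewrite u0 // mul0r.
have [p [sp pP]] := up _ jn; have [q [sq qP]] := vp _ jn.
exists (p * q); split=> [|x jx]; last by rewrite hornerM pP // qP.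
rewrite (leq_trans (size_polyMleq _ _)) //; move: sp sq; lia.
Qed.

(** Basis functions of V_n are measurable and bounded by 1 on ]0, 1[. *)
Lemma V_space_integrable k n (v : R -> R^o) : V_space k n v ->
  lebesgue_measure.-integrable [set` `]0, 1[] (EFin \o v).
Proof.
have m01 : measurable ([set` `]0, 1[] : set R) by exact: measurable_itv.
move=> /V_spaceP[c ->].
apply: (big_ind (fun f : R -> R^o => lebesgue_measure.-integrable [set` `]0, 1[] (EFin \o f))).
- exact: integrable0.
- move=> f g fi gi.
  exact: (@integrableD _ _ _ lebesgue_measure _ m01 (EFin \o f) (EFin \o g)).
move=> t _; apply: (@integrableZl _ _ _ lebesgue_measure _ m01 (c t) (EFin \o dyadic_monomial t)).
apply: measurable_bounded_integrable => //.
- by rewrite /= lebesgue_measure_itv /= lte_fin ltr01 -EFinD ltry.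
- apply: measurable_funM; last exact: exprn_measurable.
  by apply: measurable_indic; exact: measurable_itv.
exists 1; split=> // M M1 x /=; rewrite in_itv /= => /andP[x0 x1].
rewrite /dyadic_monomial normrM (le_trans _ (ltW M1)) // mulr_ile1 //.
  by rewrite indicE; case: (_ \in _); rewrite ?normr1 ?normr0.
by rewrite normrX exprn_ile1 // ger0_norm ltW.
Qed.

Lemma L2_innerC (f g : R -> R^o) : L2_inner f g = L2_inner g f.
Proof. by apply: eq_Rintegral => x _; rewrite mulrC. Qed.

(** The products of elements of V_n^k lie in V_n^(2k), so all the integrals
    involved converge. *)
Lemma L2_innerD k n a (u v w : R -> R^o) :
  V_space k n u -> V_space k n v -> V_space k n w ->
  L2_inner (a *: u + v) w = a * L2_inner u w + L2_inner v w.
Proof.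
move=> uV vV wV.
have uwi := V_space_integrable (V_spaceM uV wV).
have vwi := V_space_integrable (V_spaceM vV wV).
have m01 : measurable ([set` `]0, 1[] : set R) by exact: measurable_itv.
rewrite /L2_inner -RintegralZl // -RintegralD //; last first.
  exact: (@integrableZl _ _ _ lebesgue_measure _ m01 a (EFin \o (fun x => u x * w x))).
by apply: eq_Rintegral => x _; rewrite -[(a *: u + v) x]/(a * u x + v x) mulrDl mulrA.
Qed.

(** If v^2 has integral 0 then v vanishes almost everywhere, hence so does the
    polynomial that represents v on each dyadic interval. *)
Lemma L2_inner_aniso k n (v : R -> R^o) : V_space k n v -> L2_inner v v = 0 -> v = 0.
Proof.
move=> vV vv0.
have m01 : measurable ([set` `]0, 1[] : set R) by exact: measurable_itv.
have vvi := V_space_integrable (V_spaceM vV vV).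
(* N is a null set outside of which v^2 vanishes on ]0, 1[. *)
have [N [mN N0 vN]] : ae_eq lebesgue_measure [set` `]0, 1[]
    (EFin \o (fun x => v x * v x)) (cst 0%E).
  apply/ae_eq_integral_abs => //; first exact: measurable_int vvi.
  transitivity (L2_inner v v)%:E; last by rewrite vv0.
  rewrite /L2_inner /Rintegral fineK; last exact: integrable_fin_num.
  by apply: eq_integral => x _ /=; rewrite ger0_norm // -expr2 sqr_ge0.
have [v0 vp] := vV; apply/funext => x.
have [x01|x01] := boolP (x \in `]0, 1]); last exact: v0.
have [j jn jx] := dyadic_itv_cover n x01.
have [p [sp pP]] := vp _ jn; rewrite pP //.
suff -> : p = 0 by rewrite horner0.
apply: (@poly_ae0 _ (2 ^- n * j%:R) (2 ^- n * j.+1%:R) N) => [||y /andP[jy yj] Ny].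
- by rewrite ltr_pM2l ?invr_gt0 ?exprn_gt0 // ltr_nat.
- by exists N; split.
have jy' : dyadic_itv n j y by rewrite /dyadic_itv /= in_itv /= jy ltW.
rewrite -pP //; apply: contrapT => vy; apply/Ny/vN => /= vy0; apply: vy.
have y01 : y \in `]0, 1[.
  have := dyadic_itv_sub jn jy'; rewrite !in_itv /= => /andP[-> _] /=.
  rewrite (lt_le_trans yj) // ler_pdivrMl ?exprn_gt0 // mulr1 -natrX ler_nat //.
have [] := vy0 y01; move=> /eqP; rewrite mulf_eq0 orbb => /eqP //.
Qed.

End PiecewisePolynomials.

(** * The dimension of the sparse space *)

Section SparseDimension.
Context {R : realType}.
Local Open Scope classical_set_scope.
Local Open Scope ring_scope.

(** At positive levels the dimensions (k+1) 2^(l+1) and (k+1) 2^l of V_(l+1) and V_l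
    are subtracted. *)
Lemma W_space_basis k l : exists e : 'I_(level_weight l * k.+1) -> R -> R^o,
  is_basis (W_space k l) e.
Proof.
case: l => [|l]; first exact: (@V_space_basis R k 0).
have [b bV] := @V_space_basis R k l.+1; have [c cV] := @V_space_basis R k l.
have := orth_compl_basis (@V_space0 R _ _) (@V_space_scaleD R _ _) (@L2_innerC R)
  (@L2_innerD R _ _) (@L2_inner_aniso R _ _) bV cV (@V_spaceS R k l).
by rewrite -mulnBl expnS mul2n -addnn addnK.
Qed.

Lemma W_space_sub k l N : (l <= N)%N -> W_space k l `<=` @V_space R k N.
Proof.
move=> lN; apply: subset_trans (V_space_le lN).
by case: l {lN} => // l w [].
Qed.

(** If l < m, then W_l is contained in V_(m-1), to which W_m is orthogonal by
    definition. *)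
Lemma W_space_orth k l m (u w : R -> R^o) : l != m ->
  W_space k l u -> W_space k m w -> L2_inner u w = 0.
Proof.
wlog lm : l m u w / (l < m)%N => [wl lm lW mW|_ lW mW].
  case: (ltngtP l m) (lm) => // h _; first exact: (wl l m).
  by rewrite L2_innerC (wl m l) // eq_sym.
case: m lm mW => // m; rewrite ltnS => lm [_ wV].
by rewrite L2_innerC wV //; apply: W_space_sub lW.
Qed.

Lemma W_family_free k N (n : nat -> nat) (e : forall l, 'I_(n l) -> R -> R^o) :
    (forall l, is_basis (W_space k l) (@e l)) ->
  forall a : {l : 'I_N.+1 & 'I_(n l)} -> R,
    \sum_t a t *: e _ (tagged t) = 0 -> forall t, a t = 0.
Proof.
move=> eW a a0.
pose u (l : 'I_N.+1) := \sum_(i < n l) a (Tagged _ i) *: e l i.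
have uW (l : 'I_N.+1) : W_space k l (u l) by apply/(is_basisP (eW l)); eexists.
have uV (l : 'I_N.+1) : V_space k N (u l) by apply: W_space_sub (uW l); rewrite -ltnS.
have u0 : \sum_l u l = 0.
  rewrite -[RHS]a0 sig_big_dep /=.
  by apply: eq_bigr => -[l i] _.
move=> [l i].
apply: ((eW l).1 (fun i => a (Tagged _ i))).
apply: (orth_sum_eq0 (@V_space0 R k N) (@V_space_scaleD R _ _)
  (@L2_innerD R _ _) (@L2_inner_aniso R _ _) uV _ u0) => p q pq.
exact: W_space_orth pq (uW p) (uW q).
Qed.

Lemma sparse_V_dim d k N :
  fin_dim (sparse_V R k d N) /\
  lin_dim (sparse_V R k d N) = (k.+1 ^ d * level_count d N)%N.
Proof.
pose e l := projT1 (cid (W_space_basis k l)).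
have eW l : is_basis (W_space k l) (e l) := projT2 (cid (W_space_basis k l)).
have [b bS] := sparse_basis d eW (W_family_free (N := N) eW).
by split; [exists _, b|rewrite (lin_dimE bS) card_level_sum].
Qed.

End SparseDimension.

Theorem lemma2p3 (R : realType) :
  (forall d k N : nat, (1 <= d)%N -> (1 <= N)%N ->
     fin_dim (sparse_V R k d N) /\
     (lin_dim (sparse_V R k d N))%:R =
       (k + 1)%:R ^+ d *
       ((\sum_(0 <= m < d)
           'C(d, m)%:R *
           ((-1) ^+ (d - m) +
            2%:R ^ (N%:Z + m%:Z - d%:Z + 1) *
            \sum_(0 <= n < d - m) 'C(N, n)%:R * (-2%:R) ^+ (d - m - 1 - n)))
        + 1) :> R)
  /\
  (forall d0 : nat, exists c C : R, 0 < c /\ 0 < C /\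
     forall d k N : nat, (1 <= d)%N -> (d <= d0)%N -> (1 <= N)%N ->
       c * (k + 1)%:R ^+ d * 2%:R ^+ N * N%:R ^+ (d - 1)
         <= (lin_dim (sparse_V R k d N))%:R
         <= C * (k + 1)%:R ^+ d * 2%:R ^+ N * N%:R ^+ (d - 1)).
Proof.
split=> [d k N _ _|d0].
  have [fd ->] := @sparse_V_dim R d k N; split=> //.
  rewrite natrM natrX addn1 level_count_closed big_nat_recr //= binn subnn.
  rewrite pos_level_sum0 mulr1; congr (_ * (_ + _)).
  apply: eq_big_nat => m /andP[_ md]; rewrite /pos_level_sum /alt_binomial_sum.
  by congr (_ * (_ + _ ^ _ * _)); lia.
(* In dimension d the bounds hold with 2^(d-1) (d-1)! and 2^(d-1), which increase
   with d. *)
exists (2 ^ d0 * d0`!)%:R^-1, (2 ^ d0)%:R.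
have c0 : 0 < (2 ^ d0 * d0`!)%:R :> R.
  by rewrite ltr0n muln_gt0 expn_gt0 fact_gt0.
split; first by rewrite invr_gt0.
split; first by rewrite ltr0n expn_gt0.
move=> [|d] // k N _ dd0 N0; rewrite (sparse_V_dim d.+1 k N).2 addn1 subSS subn0.
apply/andP; split.
  rewrite -!mulrA ler_pdivrMl // -!natrX -!natrM ler_nat.
  rewrite [leqRHS]mulnCA leq_mul2l; apply/orP; right.
  apply: leq_trans (level_count_lower d N) _.
  rewrite leq_mul2r leq_mul ?orbT //; first by rewrite leq_pexp2l // ltnW.
  by rewrite leq_fact // ltnW.
rewrite -!natrX -!natrM ler_nat.
rewrite [(2 ^ d0 * _)%N]mulnC -!mulnA leq_mul2l; apply/orP; right.
apply: leq_trans (level_count_upper d N0) _.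
by rewrite -mulnA leq_mul2r leq_pexp2l ?orbT // ltnW.
Qed.
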